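(* Let $(E,\|\cdot\|)$ be a normed linear space over $\mathbb{K}$ ($\mathbb{K}=\mathbb{R}$ or $\mathbb{C}$), let $n\ge1$ and let $\mathbf{x}=(x_1,\dots,x_n)\in E^n$. Then for all real $q,r\ge1$ we have $$\|\mathbf{x}\|_{h,n,q+r}^{q+r}\le\frac1n\|\mathbf{x}\|_{h,n,q}^{q}\|\mathbf{x}\|_{h,n,r}^{r}+\frac1n\left\lfloor\frac{n^2}{4}\right\rfloor\|\mathbf{x}\|_{n,\infty}^{q+r}\le\frac1n\|\mathbf{x}\|_{h,n,q}^{q}\|\mathbf{x}\|_{h,n,r}^{r}+\frac14n\|\mathbf{x}\|_{n,\infty}^{q+r}.$$
   Context: $\lfloor t\rfloor$ is the largest integer less than or equal to $t$. For $\mathbf{x}=(x_1,\dots,x_n)\in E^n$, $\|\mathbf{x}\|_{n,\infty}:=\max_{j}\|x_j\|$. For $p\in[1,\infty]$ let $\mathbb{B}_{n,p}=\{\lambda=(\lambda_1,\dots,\lambda_n)\in\mathbb{K}^n : \|\lambda\|_{n,p}\le 1\}$, where $\|\lambda\|_{n,p}=(\sum_{k=1}^n|\lambda_k|^p)^{1/p}$ for $p<\infty$ and $\|\lambda\|_{n,\infty}=\max_k|\lambda_k|$. For real $s\ge1$, the hypo-$s$-norm on $E^n$ is $$\|\mathbf{x}\|_{h,n,s}:=\sup_{\lambda\in\mathbb{B}_{n,p}}\left\|\sum_{j=1}^n\lambda_jx_j\right\|,$$ where $p$ is the conjugate exponent of $s$ ($\frac1p+\frac1s=1$ if $s>1$;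 $p=\infty$ if $s=1$). *)

(* Defs.v *)
From HB Require Import structures.
From mathcomp Require Import all_boot all_order all_algebra.
From mathcomp Require Import all_classical all_reals all_analysis.
From mathcomp Require Import complex.

Set Implicit Arguments.
Unset Strict Implicit.
Unset Printing Implicit Defensive.

Import Order.TTheory GRing.Theory Num.Theory.
Import numFieldNormedType.Exports.

Local Open Scope classical_set_scope.
Local Open Scope complex_scope.
Local Open Scope ring_scope.

Variant scalar_kind := RealScalars | ComplexScalars.

Definition scalars (R : realType) (k : scalar_kind) : numFieldType :=
  match k with
  | RealScalars => R
  | ComplexScalars => R[i]
  end.

Definition real_part (R : realType) (k : scalar_kind) : scalars R k -> R :=
  match k return scalars R k -> R with
  | RealScalars => fun z => z
  | ComplexScalars => fun z => complex.Re z
  end.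

(* A [normedModType K] has its norm valued in K (as a nonnegative, hence real,
   element); [rnorm] is that norm as an element of R. *)
Definition rnorm (R : realType) (k : scalar_kind)
    (V : normedZmodType (scalars R k)) (v : V) : R :=
  real_part `|v|.

(* The default 0 only matters for n = 0. *)
Definition norm_infty (R : realType) (k : scalar_kind)
    (V : normedZmodType (scalars R k)) (n : nat) (x : 'I_n -> V) : R :=
  \big[Num.max/0]_(j < n) rnorm (x j).

(* Only meant for 1 <= p <= +oo; the value at p = -oo is junk. *)
Definition lp_norm (R : realType) (k : scalar_kind) (n : nat) (p : \bar R)
    (l : 'I_n -> scalars R k) : R :=
  match p with
  | p'%:E => (\sum_(j < n) rnorm (l j) `^ p') `^ p'^-1
  | _ => norm_infty l
  end.

Definition lp_ball (R : realType) (k : scalar_kind) (n : nat) (p : \bar R) :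
    set ('I_n -> scalars R k) :=
  [set l | lp_norm p l <= 1].

(* For 1 <= s the set is nonempty and bounded above, so that [sup] is the
   genuine supremum; [hoelder_conjugate 1] is +oo. *)
Definition hypo_norm (R : realType) (k : scalar_kind)
    (E : normedModType (scalars R k)) (n : nat) (s : R) (x : 'I_n -> E) : R :=
  sup [set rnorm (\sum_(j < n) l j *: x j) |
        l in @lp_ball R k n (hoelder_conjugate s%:E)].

(* Main.v *)
(** By Hahn-Banach on the span of the [x_j], for each [l] there are weights
    [0 <= b_j <= ||x_j||], the moduli [|f(x_j)|] of a norming functional [f],
    with [||sum l_j x_j|| <= sum |l_j| b_j], whose l^s norm is at most the
    hypo-s-norm of [x] for every [s >= 1].  By Hoelder the claim then reduces to
    the discrete Gruess inequality for the sequences [b_j^q] and [b_j^r]. *)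
Require Import Defs.
From HB Require Import structures.
From mathcomp Require Import all_boot all_order all_algebra.
From mathcomp Require Import all_classical all_reals all_analysis.
From mathcomp Require Import complex ring lra.

Set Implicit Arguments.
Unset Strict Implicit.
Unset Printing Implicit Defensive.

Import Order.TTheory GRing.Theory Num.Theory.

Local Open Scope ring_scope.

(** * Real numbers as scalars, and the real-valued norm *)

Definition of_real (R : realType) (k : scalar_kind) : R -> scalars R k :=
  match k with
  | RealScalars => id
  | ComplexScalars => real_complex R
  end.
Arguments of_real {R} k.

Section Scalars.
Variables (R : realType) (k : scalar_kind).
Implicit Types (a b : R) (z : scalars R k).

Lemma of_real0 : of_real k (0 : R) = 0.
Proof. by case: k. Qed.

Lemma of_real1 : of_real k (1 : R) = 1.
Proof. by case: k. Qed.

Lemma of_realD a b : of_real k (a + b) = of_real k a + of_real k b.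
Proof. by case: k => //=; rewrite rmorphD. Qed.

Lemma of_realN a : of_real k (- a) = - of_real k a.
Proof. by case: k => //=; rewrite rmorphN. Qed.

Lemma of_realM a b : of_real k (a * b) = of_real k a * of_real k b.
Proof. by case: k => //=; rewrite rmorphM. Qed.

Lemma ler_of_real a b : (of_real k a <= of_real k b) = (a <= b).
Proof. by case: k => //=; rewrite lecR. Qed.

Lemma norm_of_real a : `|of_real k a| = of_real k `|a|.
Proof. by case: k => //=; rewrite normc_def /= expr0n /= addr0 sqrtr_sqr. Qed.

Lemma of_realK a : real_part (of_real k a) = a.
Proof. by case: k. Qed.

Lemma ge0_real_partK z : 0 <= z -> of_real k (real_part z) = z.
Proof.
case: k z => // z z0 /=; case: z z0 => a b z0.
by have /= -> := ger0_Im z0.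
Qed.

Variable V : normedZmodType (scalars R k).
Implicit Types u v : V.

Lemma norm_rnorm v : `|v| = of_real k (rnorm v).
Proof. by rewrite ge0_real_partK. Qed.

Lemma rnorm_ge0 v : 0 <= rnorm v.
Proof. by rewrite -(ler_of_real) of_real0 -norm_rnorm. Qed.

Lemma rnorm0 : rnorm (0 : V) = 0.
Proof. by rewrite /rnorm normr0 -of_real0 of_realK. Qed.

Lemma ler_rnormD u v : rnorm (u + v) <= rnorm u + rnorm v.
Proof. by rewrite -ler_of_real of_realD -!norm_rnorm ler_normD. Qed.

Lemma ler_rnorm_sum n (x : 'I_n -> V) :
  rnorm (\sum_(j < n) x j) <= \sum_(j < n) rnorm (x j).
Proof.
elim/big_ind2 : _ => [|s a t b sa tb|//]; first by rewrite rnorm0.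
by rewrite (le_trans (ler_rnormD a b))// lerD.
Qed.

Lemma rnorm_of_real a : rnorm (of_real k a) = `|a|.
Proof. by rewrite /rnorm norm_of_real of_realK. Qed.

End Scalars.

Lemma rnormZ (R : realType) (k : scalar_kind) (E : normedModType (scalars R k))
  (c : scalars R k) (v : E) : rnorm (c *: v) = rnorm c * rnorm v.
Proof.
by rewrite {1}/rnorm normrZ !norm_rnorm -of_realM of_realK.
Qed.

(** * Hahn-Banach along finitely many directions *)

Section HahnBanach.
Variables (R : realType) (k : scalar_kind) (E : lmodType (scalars R k)).
Implicit Types (P Q : E -> R) (u v w : E).

(** Homogeneity is asked only as an inequality, which is easier to check for an infimum; rescaling
    by [t^-1] recovers equality in [sublinearZ]. *)
Definition sublinear P : Prop :=
  (forall u v, P (u + v) <= P u + P v) /\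
  (forall t u, 0 <= t -> P (of_real k t *: u) <= t * P u).

Lemma sublinear0 P : sublinear P -> P 0 = 0.
Proof.
move=> [PD PZ]; apply/eqP; rewrite eq_le; apply/andP; split.
  by have := PZ 0 0 (lexx _); rewrite scaler0 mul0r.
by have := PD 0 0; rewrite addr0 -subr_ge0 addrK.
Qed.

Lemma sublinearZ P t u : sublinear P -> 0 <= t ->
  P (of_real k t *: u) = t * P u.
Proof.
move=> sP; rewrite le_eqVlt => /predU1P[<-|t0].
  by rewrite of_real0 scale0r mul0r sublinear0.
have [_ PZ] := sP; apply/eqP; rewrite eq_le PZ ?(ltW t0)//=.
have ti0 : 0 <= t^-1 by rewrite invr_ge0 ltW.
have := PZ _ (of_real k t *: u) ti0.
rewrite scalerA -of_realM mulVf ?gt_eqF// of_real1 scale1r => h.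
by rewrite -ler_pdivlMl.
Qed.

(* The infimum over [t >= 0] of [P (u + t w) - t P w] is the largest sublinear
   functional below [P] that is linear along [w] with value [P w] at [w]. *)
Lemma sublinear_step P w : sublinear P ->
  exists Q, [/\ sublinear Q, forall u, Q u <= P u & Q (- w) <= - P w].
Proof.
move=> sP; have [PD PZ] := sP.
pose S u := ([set P (u + of_real k t *: w) - t * P w | t in [set t : R | 0 <= t]])%classic.
(* Subadditivity gives [t * P w <= P (u + t w) + P (- u)], so [- P (- u)] is a lower bound. *)
have lbS u : has_lbound (S u).
  exists (- P (- u)) => _ [t /= t0 <-].
  have := PD (u + of_real k t *: w) (- u).
  by rewrite addrAC subrr add0r sublinearZ//; lra.
have S0 u : (S u !=set0)%classic.
  by exists (P (u + of_real k 0 *: w) - 0 * P w), 0 => /=.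
have infP t u : 0 <= t -> inf (S u) <= P (u + of_real k t *: w) - t * P w.
  by move=> t0; apply: ge_inf => //; exists t.
exists (fun u => inf (S u)); split; first split.
(* Parameters [t] for [u] and [s] for [v] combine into [s + t] for [u + v]; below, [t] for [u]
   becomes [c * t] for [c u]. *)
- move=> u v; rewrite -lerBlDr; apply: lb_le_inf => // _ [t /= t0 <-].
  rewrite lerBlDr -lerBlDl; apply: lb_le_inf => // _ [s /= s0 <-].
  rewrite lerBlDl (le_trans (infP (s + t) _ _)) ?addr_ge0//.
  rewrite of_realD scalerDl.
  have := PD (u + of_real k t *: w) (v + of_real k s *: w).
  by rewrite addrACA [of_real k t *: w + _]addrC; lra.
- move=> c u; rewrite le_eqVlt => /predU1P[<-|c0].
    rewrite of_real0 scale0r mul0r.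
    by have := infP 0 0 (lexx _); rewrite of_real0 scale0r addr0 mul0r subr0 sublinear0.
  rewrite -ler_pdivrMl//; apply: lb_le_inf => // _ [t /= t0 <-].
  rewrite ler_pdivrMl// mulrBr mulrA -(sublinearZ _ sP) ?(ltW c0)//.
  by rewrite scalerDr scalerA -of_realM infP// mulr_ge0// ltW.
- by move=> u; have := infP 0 u (lexx _); rewrite of_real0 scale0r addr0 mul0r subr0.
- by have := infP 1 (- w) ler01; rewrite of_real1 scale1r addNr sublinear0// mul1r sub0r.
Qed.

(** Apply [sublinear_step] to the vectors of the list in turn. What has been gained survives, since
    a smaller functional can only decrease [Q w + Q (- w)]. *)
Lemma sublinear_flat P (s : seq E) : sublinear P ->
  exists Q, [/\ sublinear Q, forall u, Q u <= P u &
    {in s, forall w, Q w + Q (- w) <= 0}].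
Proof.
move=> sP; elim: s => [|w s [Q [sQ QP Qs]]]; first by exists P.
have [T [sT TQ Tw]] := sublinear_step w sQ.
exists T; split=> // [u|v]; first exact: le_trans (TQ _) (QP _).
rewrite inE => /predU1P[->|/Qs Qv]; last exact: le_trans (lerD (TQ _) (TQ _)) Qv.
by have := TQ w; lra.
Qed.

(** A first step along [u] gives [T (- u) <= - P u]. Any sublinear [Q] below [T] then has
    [Q u >= - Q (- u) >= P u], so flattening along the list keeps the value at [u]. *)
Lemma hahn_banach_fin P u (s : seq E) : sublinear P ->
  exists Q, [/\ sublinear Q, forall v, Q v <= P v, Q u = P u &
    {in s, forall w, Q w + Q (- w) <= 0}].
Proof.
move=> sP; have [T [sT TP Tu]] := sublinear_step u sP.
have [Q [sQ QT Qs]] := sublinear_flat s sT.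
have QP v : Q v <= P v by exact: le_trans (QT _) (TP _).
exists Q; split=> //; apply/eqP; rewrite eq_le QP/=.
have := sQ.1 u (- u); rewrite subrr sublinear0//.
by have := QT (- u); lra.
Qed.

Section Flat.
Variable Q : E -> R.
Hypothesis sQ : sublinear Q.
(** Subadditivity gives the reverse inequality, so [Q] is odd at such [w]. These vectors form a real
    subspace on which [Q] is linear. *)
Definition flat w := Q w + Q (- w) <= 0.

Lemma flatN w : flat w -> flat (- w).
Proof. by rewrite /flat opprK addrC. Qed.

Lemma flatD v w : flat v -> flat w -> flat (v + w).
Proof.
rewrite /flat opprD => fv fw.
by have := sQ.1 v w; have := sQ.1 (- v) (- w); lra.
Qed.

Lemma flatE w : flat w -> Q (- w) = - Q w.
Proof.
rewrite /flat => fw; have := sQ.1 w (- w); rewrite subrr sublinear0//.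
by lra.
Qed.

Lemma flatZ t w : flat w -> flat (of_real k t *: w).
Proof.
move=> fw; wlog t0 : t w fw / 0 <= t => [hw|].
  have [|t0] := leP 0 t; first exact: hw.
  rewrite -[t]opprK; have -> : of_real k (- - t) *: w = of_real k (- t) *: - w.
    by rewrite scalerN -scaleNr -of_realN.
  by apply: hw; [exact: flatN|rewrite oppr_ge0 ltW].
by rewrite /flat -scalerN !sublinearZ// -mulrDr mulr_ge0_le0.
Qed.

Lemma sublinear_flatZ t w : flat w -> Q (of_real k t *: w) = t * Q w.
Proof.
move=> fw; have [|t0] := leP 0 t; first exact: sublinearZ.
have -> : of_real k t *: w = of_real k (- t) *: - w.
  by rewrite scalerN -scaleNr -of_realN opprK.
by rewrite sublinearZ ?oppr_ge0 ?ltW// flatE// mulrNN.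
Qed.

Lemma sublinear_flatD v w : flat v -> Q (v + w) = Q v + Q w.
Proof.
move=> fv; have := sQ.1 v w; have := sQ.1 (v + w) (- v).
by rewrite addrAC subrr add0r flatE//; lra.
Qed.

Lemma flat_sum n (x : 'I_n -> E) : (forall j, flat (x j)) ->
  Q (\sum_(j < n) x j) = \sum_(j < n) Q (x j).
Proof.
move=> fx; elim/big_rec2 : _ => [|j y z _ <-]; first exact: sublinear0.
by rewrite sublinear_flatD.
Qed.

End Flat.
End HahnBanach.

(** * Cartesian form of scalars *)

(* [0] over the reals, so that [a + b * imag_unit] covers both scalar fields. *)
Definition imag_unit (R : realType) (k : scalar_kind) : scalars R k :=
  match k with
  | RealScalars => 0
  | ComplexScalars => Complex 0 1
  end.
Arguments imag_unit {R} k.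

Section Cartesian.
Variables (R : realType) (k : scalar_kind).

Lemma rnorm_scalarE (z : scalars R k) :
  rnorm z = match k return scalars R k -> R with
            | RealScalars => fun z => Num.sqrt (z ^+ 2)
            | ComplexScalars => fun z =>
                Num.sqrt (complex.Re z ^+ 2 + complex.Im z ^+ 2)
            end z.
Proof.
case: k z => z; first by rewrite sqrtr_sqr.
exact: (congr1 (@complex.Re R) (normc_def z)).
Qed.

Lemma cartesian_form (z : scalars R k) : exists a b : R,
  z = of_real k a + of_real k b * imag_unit k /\
  rnorm z = Num.sqrt (a ^+ 2 + b ^+ 2).
Proof.
rewrite rnorm_scalarE; case: k z => /= [z|[a b]].
  by exists z, 0; rewrite mulr0 addr0 expr0n addr0.
exists a, b; split=> //.
by apply/eqP; rewrite eq_complex /= !mulr0 !mul0r subr0 !addr0 add0r mulr1 !eqxx.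
Qed.

(** Only an inequality, because over the reals the [b] component is lost. *)
Lemma ler_rnorm_cartesian (a b : R) :
  rnorm (of_real k a + of_real k b * imag_unit k) <=
  Num.sqrt (a ^+ 2 + b ^+ 2).
Proof.
rewrite rnorm_scalarE; case: k => /=.
  by rewrite mulr0 addr0 ler_wsqrtr// lerDl sqr_ge0.
by rewrite !mulr0 !mul0r mulr1 subr0 !addr0 add0r.
Qed.

End Cartesian.

(** * Norming functionals and their weights *)

Section Norming.
Variables (R : realType) (k : scalar_kind).

(** By real linearity [Q ((a + b i) v) = a A + b B]. Over the unit disc this is largest at
    [c = (A + B i) / m], with value [m], the modulus of the scalar functional
    [w |-> Q w - i Q (i w)] at [v]. *)
Lemma sublinear_phase (E : lmodType (scalars R k)) (Q : E -> R) (v : E) :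
  sublinear Q -> flat Q v -> flat Q (imag_unit k *: v) ->
  exists c : scalars R k, [/\ rnorm c <= 1, flat Q (c *: v), 0 <= Q (c *: v) &
    forall z, Q (z *: v) <= rnorm z * Q (c *: v)].
Proof.
move=> sQ fv fiv.
set A := Q v; set B := Q (imag_unit k *: v); pose m := Num.sqrt (A ^+ 2 + B ^+ 2).
have AB0 : 0 <= A ^+ 2 + B ^+ 2 by rewrite addr_ge0 ?sqr_ge0.
have mm : m ^+ 2 = A ^+ 2 + B ^+ 2 by rewrite sqr_sqrtr.
have m0 : 0 <= m by exact: sqrtr_ge0.
have cartE a b : (of_real k a + of_real k b * imag_unit k) *: v =
    of_real k a *: v + of_real k b *: (imag_unit k *: v).
  by rewrite scalerDl -scalerA.
have QE a b : Q ((of_real k a + of_real k b * imag_unit k) *: v) = a * A + b * B.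
  by rewrite cartE sublinear_flatD ?sublinear_flatZ//; exact: flatZ.
pose c := of_real k (A / m) + of_real k (B / m) * imag_unit k.
have Qc : Q (c *: v) = m.
  (* If [m = 0], then [A = B = 0], and division by zero yields [c = 0], which still works. *)
  rewrite QE; have [->|mN0] := eqVneq m 0.
    by move: mm; rewrite invr0; nra.
  by apply: (mulIf mN0); rewrite mulrDl -!mulrA; field: mm.
exists c; split.
- apply: (le_trans (ler_rnorm_cartesian _ _ _)).
  rewrite -sqrtr1 ler_wsqrtr// !exprMn -mulrDl -mm -exprMn.
  have [->|mN0] := eqVneq m 0; first by rewrite mul0r expr0n ler01.
  by rewrite divff// expr1n.
- by rewrite cartE; apply: flatD => //; exact: flatZ.
- by rewrite Qc.
- move=> z; have [a [b [-> ->]]] := cartesian_form z.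
  rewrite QE Qc -sqrtrM ?addr_ge0 ?sqr_ge0//.
  apply: (le_trans (ler_norm _)); rewrite -sqrtr_sqr ler_wsqrtr//.
  (* Cauchy-Schwarz in the plane, from the Lagrange identity. *)
  have := sqr_ge0 (a * B - b * A); nra.
Qed.

Lemma sublinear_rnorm (E : normedModType (scalars R k)) :
  sublinear (@rnorm R k E).
Proof.
by split=> [u v|t u t0]; [exact: ler_rnormD|rewrite rnormZ rnorm_of_real ger0_norm].
Qed.

(** The weights are [Q (c_j x_j)], with [Q] norming the given combination and [c_j] the phase from
    [sublinear_phase]. The last clause, with [m_j = t_j c_j], turns a pairing of [b] with
    nonnegative [t] into the norm of a combination of the [x_j]; this will bound the l^s norms of
    [b]. *)
Lemma norming_weights (E : normedModType (scalars R k)) (n : nat)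
    (x : 'I_n -> E) (l : 'I_n -> scalars R k) :
  exists b : 'I_n -> R, [/\ forall j, 0 <= b j <= rnorm (x j),
    rnorm (\sum_(j < n) l j *: x j) <= \sum_(j < n) rnorm (l j) * b j &
    forall t : 'I_n -> R, (forall j, 0 <= t j) ->
      exists m : 'I_n -> scalars R k, (forall j, rnorm (m j) <= t j) /\
        \sum_(j < n) t j * b j <= rnorm (\sum_(j < n) m j *: x j)].
Proof.
(* Flatness at both [x_j] and [i x_j] makes [Q] real-linear on all scalar multiples of [x_j]. *)
pose s := codom x ++ codom (fun j => imag_unit k *: x j).
have [Q [sQ Qle Qu Qs]] :=
  hahn_banach_fin (\sum_(j < n) l j *: x j) s (sublinear_rnorm E).
have fx j : flat Q (x j) by apply: Qs; rewrite mem_cat codom_f.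
have fix_ j : flat Q (imag_unit k *: x j).
  by apply: Qs; rewrite mem_cat orbC (codom_f (fun j => imag_unit k *: x j)).
have /choice[c cP] j := sublinear_phase sQ (fx j) (fix_ j).
exists (fun j => Q (c j *: x j)); split.
- move=> j; have [c1 _ -> _] := cP j; rewrite (le_trans (Qle _))// rnormZ.
  by rewrite ler_piMl// rnorm_ge0.
- rewrite -Qu; apply: (@le_trans _ _ (\sum_(j < n) Q (l j *: x j))).
    elim/big_ind2 : _ => [|a p b q ap bq|//]; first by rewrite sublinear0.
    by rewrite (le_trans (sQ.1 _ _))// lerD.
  by apply: ler_sum => j _; have [_ _ _] := cP j; exact.
- move=> t t0; exists (fun j => of_real k (t j) * c j); split=> [j|].
    have [c1 _ _ _] := cP j.
    have -> : rnorm (of_real k (t j) * c j) = t j * rnorm (c j).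
      rewrite {1}/rnorm normrM norm_of_real norm_rnorm -of_realM of_realK.
      by rewrite ger0_norm.
    by rewrite ler_piMr.
  rewrite (le_trans _ (Qle _))// (flat_sum sQ) => [|j].
    apply: ler_sum => j _; rewrite -scalerA sublinearZ//.
  by rewrite -scalerA; apply: flatZ => //; have [] := cP j.
Qed.

End Norming.

(** * The Hoelder and discrete Gruess inequalities *)

Section FiniteSums.
Variables (R : realType) (n : nat).
Implicit Types a b c : 'I_n -> R.

(** Divide [b] by its l^s norm [beta] and apply Young's inequality termwise; the total is at most
    [p^-1 + s^-1 = 1]. If [B = 0], all [b_j] vanish. *)
Lemma hoelder_sum (p s : R) a b : 0 < p -> 0 < s -> p^-1 + s^-1 = 1 ->
  (forall j, 0 <= a j) -> (forall j, 0 <= b j) ->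
  \sum_(j < n) a j `^ p <= 1 ->
  \sum_(j < n) a j * b j <= (\sum_(j < n) b j `^ s) `^ s^-1.
Proof.
move=> p0 s0 ps a0 b0 a1; set B := \sum_(j < n) b j `^ s.
have B0 : 0 <= B by apply: sumr_ge0 => j _; exact: powR_ge0.
have [B00|BN0] := eqVneq B 0.
  rewrite big1 ?powR_ge0// => j _.
  have /eqP := B00; rewrite psumr_eq0 => [|i _]; last exact: powR_ge0.
  by move=> /allP/(_ j); rewrite mem_index_enum powR_eq0 => /(_ isT)/andP[/eqP-> _]; rewrite mulr0.
set beta := B `^ s^-1.
have beta0 : 0 < beta by rewrite powR_gt0// lt0r BN0.
have betas : beta `^ s = B by rewrite -powRrM mulVf ?gt_eqF// powRr1.
rewrite -[leRHS]mul1r -ler_pdivrMr// mulr_suml -ps.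
apply: (@le_trans _ _ (\sum_(j < n) (a j `^ p / p + (b j / beta) `^ s / s))).
  apply: ler_sum => j _; rewrite -mulrA; apply: conjugate_powR => //.
  by rewrite divr_ge0// ltW.
rewrite big_split/= -!mulr_suml lerD//.
  by rewrite -[leRHS]mul1r ler_wpM2r// invr_ge0 ltW.
rewrite -[leRHS]mul1r ler_wpM2r ?invr_ge0 ?(ltW s0)//.
under eq_bigr => j _ do rewrite powRM ?invr_ge0 ?(ltW beta0)//.
rewrite -mulr_suml -/B -powR_inv1 ?(ltW beta0)// -powRrM mulN1r powRN betas.
by rewrite divff.
Qed.

(* Only the [k] indices with [n a_j > \sum a] contribute positively to
   [\sum_j (n a_j - \sum a) c_j], at most [k (n - k) alpha gamma] in total. *)
Lemma gruss_sum a c (alpha gamma : R) :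
  (forall j, 0 <= a j <= alpha) -> (forall j, 0 <= c j <= gamma) ->
  n%:R * \sum_(j < n) a j * c j <=
  (\sum_(j < n) a j) * (\sum_(j < n) c j)
  + (Num.floor (n%:R ^+ 2 / 4 : R))%:~R * (alpha * gamma).
Proof.
case: n a c => [|n'] a c ha hc.
  by rewrite !big_ord0 !mul0r expr0n mul0r add0r floor0 mul0r.
move: n' a c ha hc => m; set N := m.+1 => a c ha hc.
have alpha0 : 0 <= alpha by have /andP[a0 aA] := ha ord0; exact: le_trans aA.
have gamma0 : 0 <= gamma by have /andP[a0 aA] := hc ord0; exact: le_trans aA.
set A := \sum_(j < N) a j.
pose p := [pred j : 'I_N | A < N%:R * a j].
pose d : R := #|p|%:R.
have dN : d <= N%:R by rewrite ler_nat -[leqRHS]card_ord max_card.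
(* [d (N - d)] is an integer, and [(N - 2 d)^2 >= 0] bounds it by [N^2 / 4], hence by the floor. *)
have floorP : d * (N%:R - d) <= (Num.floor (N%:R ^+ 2 / 4 : R))%:~R.
  have -> : d * (N%:R - d) = (#|p| * (N - #|p|))%N%:~R.
    by rewrite -pmulrn natrM natrB// -[leqRHS]card_ord max_card.
  rewrite ler_int floor_ge_int -pmulrn natrM natrB; last first.
    by rewrite -[leqRHS]card_ord max_card.
  rewrite -/d; have := sqr_ge0 (N%:R - 2 * d); nra.
rewrite -lerBlDl.
have -> : N%:R * \sum_(j < N) a j * c j - A * \sum_(j < N) c j =
    \sum_(j < N) (N%:R * a j - A) * c j.
  rewrite !mulr_sumr -sumrB; apply: eq_bigr => j _; ring.
apply: (@le_trans _ _ (\sum_(j < N | p j) (N%:R * a j - A) * gamma)).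
  rewrite [leRHS]big_mkcond; apply: ler_sum => j _; have /andP[c0 cg] := hc j.
  case: ifPn => [pj|]; first by rewrite ler_wpM2l// subr_ge0 ltW.
  by rewrite /= -leNgt => pj; rewrite mulr_le0_ge0// subr_le0.
rewrite -mulr_suml mulrA ler_wpM2r//.
apply: le_trans (ler_wpM2r alpha0 floorP).
rewrite sumrB -mulr_sumr sumr_const -[A *+ _]mulr_natl -/d.
set T := \sum_(j < N | p j) a j.
(* The sum to bound is [N T - d A]; splitting [A] leaves [(N - d) T] minus a nonnegative term, and
   [T <= d alpha]. *)
have -> : A = T + \sum_(j < N | ~~ p j) a j by rewrite /A (bigID p).
rewrite mulrDr opprD addrA -mulrBl.
have T1 : T <= d * alpha.
  rewrite /d mulr_natl -sumr_const; apply: ler_sum => j _.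
  by have /andP[] := ha j.
have T2 : 0 <= \sum_(j < N | ~~ p j) a j.
  by apply: sumr_ge0 => j _; have /andP[] := ha j.
have d0 : 0 <= d by exact: ler0n.
rewrite lerBlDr ler_wpDr ?mulr_ge0//.
apply: le_trans (ler_wpM2l _ T1) _; first by rewrite subr_ge0.
by rewrite mulrA [_ * d]mulrC.
Qed.

End FiniteSums.

(** * Dual balls and hypo-norms *)

Lemma powR_le1 (R : realType) (y e : R) : 0 < e -> 0 <= y ->
  (y `^ e <= 1) = (y <= 1).
Proof.
move=> e0 y0; have e1 : 1 `^ e = 1 :> R by rewrite powR1.
apply/idP/idP => h; last by rewrite -e1 ge0_ler_powR ?nnegrE// ltW.
rewrite leNgt; apply/negP => y1; move: h; apply/negP.
by rewrite -ltNge -[ltLHS]e1 gt0_ltr_powR ?nnegrE.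
Qed.

Section HypoNorm.
Variables (R : realType) (k : scalar_kind) (E : normedModType (scalars R k)).
Variables (n : nat) (x : 'I_n -> E).
Implicit Types (s : R) (l : 'I_n -> scalars R k).

Lemma hoelder_conjugate_gt1 s : 1 < s ->
  hoelder_conjugate s%:E = (s / (s - 1))%:E.
Proof.
move=> s1; rewrite /hoelder_conjugate/= eqe gt_eqF ?(lt_trans ltr01)//.
by rewrite inver subr_eq0 gt_eqF.
Qed.

Lemma lp_ball1P l :
  lp_ball (hoelder_conjugate 1%:E) l <-> forall j, rnorm (l j) <= 1.
Proof.
rewrite hoelder_conjugate1 /lp_ball/=; split => [h j|h].
  exact: le_trans (le_bigmax _ (fun j => rnorm (l j)) j) h.
by apply: bigmax_le => // j _.
Qed.

Lemma lp_ballP s l : 1 < s -> lp_ball (hoelder_conjugate s%:E) l <->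
  \sum_(j < n) rnorm (l j) `^ (s / (s - 1)) <= 1.
Proof.
move=> s1; rewrite hoelder_conjugate_gt1// /lp_ball/= powR_le1//.
  by rewrite invr_gt0 divr_gt0 ?subr_gt0// (lt_trans ltr01).
by apply: sumr_ge0 => j _; exact: powR_ge0.
Qed.

Lemma lp_ball_rnorm_le1 s l j : 1 <= s ->
  lp_ball (hoelder_conjugate s%:E) l -> rnorm (l j) <= 1.
Proof.
rewrite le_eqVlt => /predU1P[<- /lp_ball1P//|s1 /(lp_ballP _ s1) h].
have p0 : 0 < s / (s - 1) by rewrite divr_gt0 ?subr_gt0// (lt_trans ltr01).
rewrite -(@powR_le1 _ _ (s / (s - 1))) ?rnorm_ge0//; apply: le_trans h.
rewrite (bigD1 j)//= lerDl; apply: sumr_ge0 => i _; exact: powR_ge0.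
Qed.

Lemma lp_ball0 s : 1 <= s ->
  lp_ball (hoelder_conjugate s%:E) (fun _ : 'I_n => 0 : scalars R k).
Proof.
rewrite le_eqVlt => /predU1P[<-|s1].
  by apply/lp_ball1P => j; rewrite rnorm0.
apply/lp_ballP => //; rewrite big1// => j _.
by rewrite rnorm0 powR0// mulf_neq0 ?invr_eq0 ?subr_eq0 ?gt_eqF// (lt_trans ltr01).
Qed.

(** Coefficients in the ball have modulus at most 1, so the sum of the norms of the [x_j] bounds the
    set and [sup] is a genuine supremum. *)
Lemma rnorm_le_hypo_norm s l : 1 <= s ->
  lp_ball (hoelder_conjugate s%:E) l ->
  rnorm (\sum_(j < n) l j *: x j) <= hypo_norm s x.
Proof.
move=> s1 lB; apply: ub_le_sup; last by exists l.
exists (\sum_(j < n) rnorm (x j)) => _ [l' l'B <-].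
rewrite (le_trans (ler_rnorm_sum _))//; apply: ler_sum => j _.
by rewrite rnormZ ler_piMl ?rnorm_ge0// (lp_ball_rnorm_le1 _ s1 l'B).
Qed.

(** This is the equality case of Hoelder: a [t] in the dual unit ball whose pairing with [b] is the
    l^s norm of [b] yields, through the hypothesis, an admissible combination of at least that
    norm. *)
Lemma hypo_norm_dual s (b : 'I_n -> R) : 1 <= s -> (forall j, 0 <= b j) ->
  (forall t : 'I_n -> R, (forall j, 0 <= t j) ->
    exists m : 'I_n -> scalars R k, (forall j, rnorm (m j) <= t j) /\
      \sum_(j < n) t j * b j <= rnorm (\sum_(j < n) m j *: x j)) ->
  \sum_(j < n) b j `^ s <= hypo_norm s x `^ s.
Proof.
move=> s1 b0 hb; have s0 : 0 < s := lt_le_trans ltr01 s1.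
set B := \sum_(j < n) b j `^ s.
have B0 : 0 <= B by apply: sumr_ge0 => j _; exact: powR_ge0.
suff [y [y0 By yh]] : exists y, [/\ 0 <= y, B <= y `^ s & y <= hypo_norm s x].
  apply: (le_trans By); rewrite ge0_ler_powR ?nnegrE ?(ltW s0)//.
  exact: le_trans yh.
move: (s1); rewrite le_eqVlt => /predU1P[s1'|s1'].
  (* For [s = 1] the dual ball is that of the sup norm, and the constant 1 is extremal. *)
  have [m [m1 hm]] := hb (fun=> 1) (fun=> ler01); exists B.
  have -> : B `^ s = B by rewrite -s1' powRr1.
  split=> //; apply: (@le_trans _ _ (rnorm (\sum_(j < n) m j *: x j))).
    apply: le_trans hm; apply: ler_sum => j _.
    by rewrite -s1' powRr1// mul1r.
  by apply: rnorm_le_hypo_norm => //; rewrite -s1'; apply/lp_ball1P.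
have [B00|BN0] := eqVneq B 0.
  exists 0; rewrite powR0 ?gt_eqF// B00; split=> //.
  have := rnorm_le_hypo_norm s1 (lp_ball0 s1).
  exact/le_trans/rnorm_ge0.
have Bp : 0 < B by rewrite lt0r BN0.
have sN0 : s != 0 by rewrite gt_eqF.
have s1N0 : s - 1 != 0 by rewrite subr_eq0 gt_eqF.
set p := s / (s - 1).
have p0 : 0 < p by rewrite divr_gt0 ?subr_gt0.
have pN0 : p != 0 by rewrite gt_eqF.
(* The Hoelder extremizer: since [(s - 1) p = s], its p-th powers sum to 1, and its pairing with [b]
   is [B^(1 - 1/p) = B^(1/s)]. *)
pose t j := b j `^ (s - 1) / B `^ p^-1.
have t0 j : 0 <= t j by rewrite divr_ge0 ?powR_ge0.
have [m [mt hm]] := hb t t0.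
exists (B `^ s^-1); split; first exact: powR_ge0.
  by rewrite -powRrM mulVf// powRr1.
apply: (@le_trans _ _ (rnorm (\sum_(j < n) m j *: x j))).
  apply: le_trans hm; rewrite le_eqVlt; apply/orP; left; apply/eqP.
  have -> : s^-1 = 1 - p^-1 by rewrite /p; field; rewrite s1N0 sN0.
  rewrite powRB ?BN0 ?implybT// powRr1// mulr_suml; apply: eq_bigr => j _.
  by rewrite /t mulrAC [_ * b j]mulrC mulr_powRB1.
apply: rnorm_le_hypo_norm => //; apply/lp_ballP => //; rewrite -/p.
apply: (@le_trans _ _ (\sum_(j < n) t j `^ p)).
  apply: ler_sum => j _.
  by rewrite ge0_ler_powR ?nnegrE ?rnorm_ge0 ?(ltW p0).
rewrite le_eqVlt; apply/orP; left; apply/eqP.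
under eq_bigr => j _.
  rewrite /t powRM ?invr_ge0 ?powR_ge0// -powRrM.
  have -> : (s - 1) * p = s by rewrite /p mulrC divfK.
  over.
rewrite -mulr_suml -/B -powRN -powRrM mulNr mulVf// powR_inv1//.
by rewrite divff.
Qed.

End HypoNorm.

Theorem theorem5 (R : realType) (k : scalar_kind)
    (E : normedModType (scalars R k)) (n : nat) (hn : (1 <= n)%N)
    (x : 'I_n -> E) (q r : R) (hq : 1 <= q) (hr : 1 <= r) :
  hypo_norm (q + r) x `^ (q + r) <=
    n%:R^-1 * (hypo_norm q x `^ q * hypo_norm r x `^ r)
      + n%:R^-1 * (Num.floor (n%:R ^+ 2 / 4 : R))%:~R
        * norm_infty x `^ (q + r) /\
  n%:R^-1 * (hypo_norm q x `^ q * hypo_norm r x `^ r)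
      + n%:R^-1 * (Num.floor (n%:R ^+ 2 / 4 : R))%:~R
        * norm_infty x `^ (q + r) <=
    n%:R^-1 * (hypo_norm q x `^ q * hypo_norm r x `^ r)
      + 4^-1 * n%:R * norm_infty x `^ (q + r).
Proof.
have n0 : 0 < n%:R :> R by rewrite ltr0n.
split; last first.
  rewrite lerD2l ler_wpM2r ?powR_ge0// ler_pdivrMl//.
  apply: le_trans (floor_le _) _.
  by rewrite le_eqVlt; apply/orP; left; apply/eqP; ring.
set rhs := (X in _ <= X); set s := q + r.
have s1 : 1 < s by rewrite /s; lra.
have s0 : 0 < s := lt_trans ltr01 s1.
have sN0 : s != 0 by rewrite gt_eqF.
(* The bound is proved for each admissible [l] separately, as the weights depend on [l]; the
   supremum is taken at the end. *)
have key l : lp_ball (hoelder_conjugate s%:E) l ->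
    rnorm (\sum_(j < n) l j *: x j) `^ s <= rhs.
  move=> lB; have [b [bx lb hb]] := norming_weights x l.
  have b0 j : 0 <= b j by have /andP[] := bx j.
  have bM j : b j <= norm_infty x.
    have /andP[_ bj] := bx j; apply: (le_trans bj).
    exact: (le_bigmax _ (fun j => rnorm (x j))).
  have M0 : 0 <= norm_infty x.
    by rewrite (le_trans (b0 (Ordinal hn)))//.
  have bs0 : 0 <= \sum_(j < n) b j `^ s.
    by apply: sumr_ge0 => j _; exact: powR_ge0.
  apply: (@le_trans _ _ (\sum_(j < n) b j `^ s)).
    have lb' : rnorm (\sum_(j < n) l j *: x j) <= (\sum_(j < n) b j `^ s) `^ s^-1.
      apply: (le_trans lb); apply: (@hoelder_sum _ _ (s / (s - 1))) => //.
      - by rewrite divr_gt0 ?subr_gt0.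
      - by field; rewrite !gt_eqF ?subr_gt0.
      - by move=> j; exact: rnorm_ge0.
      - exact/lp_ballP.
    rewrite -[leRHS]powRr1// -[X in _ <= _ `^ X](mulVf sN0) powRrM.
    by rewrite ge0_ler_powR ?nnegrE ?rnorm_ge0 ?powR_ge0 ?(ltW s0).
  have powRDs (y : R) : y `^ s = y `^ q * y `^ r.
    by rewrite powRD// (negbTE sN0).
  rewrite /rhs -/s powRDs -mulrA -mulrDr ler_pdivlMl//.
  under eq_bigr => j _ do rewrite powRDs.
  have pow_itv (e : R) j : 1 <= e -> 0 <= b j `^ e <= norm_infty x `^ e.
    by move=> e1; rewrite powR_ge0 ge0_ler_powR ?nnegrE ?(le_trans ler01 e1).
  (* Gruess for [b_j^q] and [b_j^r], bounded by the matching powers of the sup norm;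
     [hypo_norm_dual] then controls the two sums. *)
  apply: le_trans (gruss_sum (fun j => pow_itv q j hq) (fun j => pow_itv r j hr)) _.
  rewrite lerD2r ler_pM// ?sumr_ge0// => [j _|j _||]; try exact: powR_ge0.
  - exact: hypo_norm_dual.
  - exact: hypo_norm_dual.
(* Needed to take s-th roots: the supremum is over norms, whereas [key] bounds their s-th powers. *)
have rhs0 : 0 <= rhs.
  have := key _ (lp_ball0 k n (ltW s1)); exact/le_trans/powR_ge0.
rewrite -[leRHS]powRr1// -[X in _ <= _ `^ X](mulVf sN0) powRrM.
have hypo_le : hypo_norm s x <= rhs `^ s^-1.
  apply: ge_sup.
    by eexists; exists (fun=> 0); [exact: lp_ball0 (ltW s1)|].
  move=> _ [l /key lk <-].
  rewrite -[leLHS]powRr1 ?rnorm_ge0// -[X in _ `^ X <= _](mulfV sN0) powRrM.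
  by rewrite ge0_ler_powR ?nnegrE ?powR_ge0 ?invr_ge0 ?(ltW s0).
rewrite ge0_ler_powR ?nnegrE ?powR_ge0 ?(ltW s0)//.
have := rnorm_le_hypo_norm x (ltW s1) (lp_ball0 k n (ltW s1)).
exact/le_trans/rnorm_ge0.
Qed.
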